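(* There is a sequence $(\phi_h)_{h\geq 1}$ of first-order sentences over the signature $\{E\}$ ($E$ binary) of size $O(h)$ such that for each $h\geq 1$, every sentence in Barthelmann-Schwentick normal form that is equivalent to $\phi_h$ on $\mathfrak{F}_{\leqslant h}$ has size $>\mathrm{Tower}(h)$.
   Context: $\mathrm{Tower}(0,x):=x$, $\mathrm{Tower}(k+1,x):=2^{\mathrm{Tower}(k,x)}$, $\mathrm{Tower}(h):=\mathrm{Tower}(h,1)$. A forest is a finite directed graph (a $\{E\}$-structure) in which every vertex has indegree at most $1$ and whose underlying undirected graph is acyclic; roots are vertices of indegree $0$; its height is the length of the longest directed path starting at a root. $\mathfrak{F}_{\leqslant h}$ is the class of all finite forests of height $\leq h$. The size of a formula is its length as a word. A formula $\phi(\overline{y},z)$ is $r$-local around $z$ if for every structure $\mathcal{A}$ and all tuples, $\mathcal{A}\models\phi[\overline{a},c]$ iff $\mathcal{A}[\{\text{entries of }\overline{a}\}\cup N_r^{\mathcal{A}}(c)]\models\phi[\overline{a},c]$, where $N_r^{\mathcal{A}}(c)$ is the set of elements at distance $\leq r$ from $c$ in the Gaifman graph. A sentence is in Barthelmann-Schwentick normal form if it has the form $\exists y_1\cdots\exists y_n\forall z\,\phi(y_1,\dots,y_n,z)$ with $n\ge0$ and $\phi$ $r$-local around $z$ for some $r\geq0$. *)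

(* Defs.v *)
From mathcomp Require Import all_boot.

Set Implicit Arguments.
Unset Strict Implicit.
Unset Printing Implicit Defensive.

Fixpoint Tower2 (k x : nat) : nat :=
  if k is k'.+1 then 2 ^ Tower2 k' x else x.

Definition Tower (h : nat) : nat := Tower2 h 1.

Inductive formula : Type :=
| Edge of nat & nat
| Equal of nat & nat
| Not of formula
| And of formula & formula
| Or of formula & formula
| Imp of formula & formula
| Iff of formula & formula
| Exists of nat & formula
| Forall of nat & formula.

(* The alphabet is infinite: every variable is a single symbol. *)
Inductive symbol : Type :=
| SVar of nat
| SE | SEqual | SNot | SAnd | SOr | SImp | SIff | SExists | SForall
| SLpar | SRpar | SComma.

Fixpoint word (f : formula) : seq symbol :=
  match f with
  | Edge x y => [:: SE; SLpar; SVar x; SComma; SVar y; SRpar]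
  | Equal x y => [:: SVar x; SEqual; SVar y]
  | Not f => SNot :: word f
  | And f g => SLpar :: word f ++ SAnd :: word g ++ [:: SRpar]
  | Or f g => SLpar :: word f ++ SOr :: word g ++ [:: SRpar]
  | Imp f g => SLpar :: word f ++ SImp :: word g ++ [:: SRpar]
  | Iff f g => SLpar :: word f ++ SIff :: word g ++ [:: SRpar]
  | Exists x f => SExists :: SVar x :: word f
  | Forall x f => SForall :: SVar x :: word f
  end.

Definition fsize (f : formula) : nat := size (word f).

Fixpoint free_vars (f : formula) : seq nat :=
  match f with
  | Edge x y | Equal x y => [:: x; y]
  | Not f => free_vars f
  | And f g | Or f g | Imp f g | Iff f g => free_vars f ++ free_vars g
  | Exists x f | Forall x f => [seq y <- free_vars f | y != x]
  end.

Definition sentence (f : formula) : Prop := free_vars f = [::].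

(* {E}-structures, finite or infinite. Nonemptiness of the universe is not a
   field: it is implied by the presence of an assignment wherever one is
   quantified over, and is required explicitly of forests. *)
Record structure : Type := Structure {
  carrier :> Type;
  edge : carrier -> carrier -> Prop
}.

Definition update (A : Type) (v : nat -> A) (x : nat) (a : A) : nat -> A :=
  fun y => if y == x then a else v y.

Fixpoint sat (A : structure) (v : nat -> A) (f : formula) : Prop :=
  match f with
  | Edge x y => edge (v x) (v y)
  | Equal x y => v x = v y
  | Not f => ~ sat v f
  | And f g => sat v f /\ sat v g
  | Or f g => sat v f \/ sat v g
  | Imp f g => sat v f -> sat v g
  | Iff f g => sat v f <-> sat v g
  | Exists x f => exists a : A, sat (update v x a) f
  | Forall x f => forall a : A, sat (update v x a) f
  end.

(* Only meant for sentences on nonempty structures, where the truth value does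
   not depend on the assignment. *)
Definition models (A : structure) (f : formula) : Prop :=
  forall v : nat -> A, sat v f.

Definition gaifman (A : structure) (a b : A) : Prop :=
  a <> b /\ (edge a b \/ edge b a).

Fixpoint nbhd (A : structure) (r : nat) (c x : A) : Prop :=
  match r with
  | 0 => x = c
  | r'.+1 => nbhd r' c x \/ exists y : A, nbhd r' c y /\ gaifman y x
  end.

Definition induced (A : structure) (S : A -> Prop) : structure :=
  @Structure {x : A | S x} (fun a b => edge (sval a) (sval b)).

(* phi(ys, z) is r-local around z. As the variables z :: ys are pairwise
   distinct in the use below, (a, c) ranges over all tuples when the assignment
   v does, with a = v ys and c = v z; w is the same tuple read in the induced
   substructure. Values on variables outside z :: ys play no role, since they
   are not free in phi. *)
Definition local_around (r : nat) (ys : seq nat) (z : nat) (phi : formula) :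
    Prop :=
  forall (A : structure) (v : nat -> A),
  let S x := (exists2 y, y \in ys & x = v y) \/ nbhd r (v z) x in
  forall w : nat -> induced S,
    (forall y, y \in z :: ys -> sval (w y) = v y) ->
    sat v phi <-> sat w phi.

Definition BSNF (psi : formula) : Prop :=
  exists (ys : seq nat) (z : nat) (phi : formula) (r : nat),
    [/\ uniq (z :: ys),
        {subset free_vars phi <= z :: ys},
        local_around r ys z phi
      & psi = foldr Exists (Forall z phi) ys].

Section Forests.
Variables (T : finType) (e : rel T).

Definition graph : structure := @Structure T (fun x y => e x y).

Definition indegree (x : T) : nat := #|[set y | e y x]|.

Definition root (x : T) : bool := indegree x == 0.

Definition undirected : rel T := fun x y => e x y || e y x.

(* Loops and pairs of antiparallel edges count as cycles (of length 1 and 2);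
   the bound 2 in the second clause is there because a single edge x -> y
   already makes [:: x; y] a closed walk of the symmetric closure. *)
Definition undirected_acyclic : Prop :=
  (forall x y, e x y -> ~~ e y x) /\
  (forall c : seq T, ucycle undirected c -> size c <= 2).

Definition is_forest : Prop :=
  [/\ 0 < #|T|, forall x, indegree x <= 1 & undirected_acyclic].

(* Length of a path = its number of edges; a path repeats no vertex, whence
   the bound n < #|T|. *)
Definition height : nat :=
  \max_(x | root x)
    \max_(n < #|T| | [exists p : n.-tuple T, path e x p && uniq (x :: p)]) n.

End Forests.

Definition equiv_on_forests (h : nat) (f g : formula) : Prop :=
  forall (T : finType) (e : rel T), is_forest e -> height e <= h ->
    models (graph e) f <-> models (graph e) g.

(* Main.v *)
Require Import Defs.
From mathcomp Require Import all_boot zify.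
From Stdlib Require Import ProofIrrelevance.

Set Implicit Arguments.
Unset Strict Implicit.
Unset Printing Implicit Defensive.

(** A number [i < Tower h] is coded by the tree of height at most [h] whose
root has one subtree, coding [j], for each bit [j] of [i]; equality of two coded
numbers is expressible by a formula of size [O(h)]. The sentence [twin_formula h]
says that every root has a twin, that is, another root coding the same number.
It holds in the forest with two copies of every tree, and fails once one of
these trees is deleted. A normal form with fewer than [2 * Tower h] existential
variables cannot tell the two forests apart: some tree contains no witness, and
the local formula does not notice its deletion. *)

(** * Invariance of satisfaction under changes of assignment and isomorphisms *)

Lemma sat_coincidence (A : structure) (f : formula) (v w : nat -> A) :
  {in free_vars f, v =1 w} -> sat v f <-> sat w f.
Proof.
elim: f v w => [x y|x y|f IH|f IHf g IHg|f IHf g IHg|f IHf g IHg|f IHf g IHg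
  |x f IH|x f IH] v w vw /=; try
  (have /IHf Ef : {in free_vars f, v =1 w}
     by move=> y yf; apply: vw; rewrite mem_cat yf);
  try (have /IHg Eg : {in free_vars g, v =1 w}
     by move=> y yg; apply: vw; rewrite mem_cat yg orbT); try tauto.
- by rewrite !vw ?inE ?eqxx ?orbT.
- by rewrite !vw ?inE ?eqxx ?orbT.
- by have := IH _ _ vw; tauto.
- have E a : sat (update v x a) f <-> sat (update w x a) f.
    apply: IH => y yf; rewrite /update; case: eqVneq => // yx.
    by apply: vw; rewrite mem_filter yx.
  by split=> -[a /E]; exists a.
- have E a : sat (update v x a) f <-> sat (update w x a) f.
    apply: IH => y yf; rewrite /update; case: eqVneq => // yx.
    by apply: vw; rewrite mem_filter yx.
  by split=> H a; apply/E.
Qed.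

Lemma sat_isomorphism (A B : structure) (F : A -> B) (f : formula) :
    injective F -> (forall b, exists a, F a = b) ->
    (forall x y, edge (F x) (F y) <-> edge x y) ->
  forall v, sat v f <-> sat (F \o v) f.
Proof.
move=> injF surjF edgeF.
elim: f => [x y|x y|f IH|f IHf g IHg|f IHf g IHg|f IHf g IHg|f IHf g IHg
  |x f IH|x f IH] v /=; try
  (have := IHf v; have := IHg v; tauto).
- by have := edgeF (v x) (v y); tauto.
- by split=> [->|/injF].
- by have := IH v; tauto.
- have E a : sat (update v x a) f <-> sat (update (F \o v) x (F a)) f.
    apply: iff_trans (IH _) _; apply: sat_coincidence => y _.
    by rewrite /= /update; case: eqP.
  split=> [[a /E]|[b]]; first by exists (F a).
  by have [a <-] := surjF b => /E; exists a.
- have E a : sat (update v x a) f <-> sat (update (F \o v) x (F a)) f.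
    apply: iff_trans (IH _) _; apply: sat_coincidence => y _.
    by rewrite /= /update; case: eqP.
  split=> H; last by move=> a; apply/E.
  by move=> b; have [a <-] := surjF b; apply/E.
Qed.

Lemma sat_exists_witness (A : structure) (ys : seq nat) (f : formula)
    (v : nat -> A) :
  sat v (foldr Exists f ys) <->
  exists2 w, (forall x, x \notin ys -> w x = v x) & sat w f.
Proof.
elim: ys v => [|y ys IH] v /=.
  split=> [|[w wv]]; first by exists v.
  by apply: (proj1 (sat_coincidence _)) => x _; apply: wv.
split=> [[a /IH[w wv wf]]|[w wv wf]].
  exists w => // x; rewrite inE negb_or => /andP[xy xys].
  by rewrite wv // /update (negbTE xy).
exists (w y); apply/IH; exists w => // x xys; rewrite /update.
by case: eqVneq => [->//|xy]; apply: wv; rewrite inE negb_or xy.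
Qed.

(** * Local formulas and embeddings onto unions of connected components *)

Section ComponentEmbedding.
Variables (A B : structure) (F : A -> B).
Hypothesis injF : injective F.
Hypothesis edgeF : forall x y, edge (F x) (F y) <-> edge x y.
Hypothesis closedF :
  forall a b, edge (F a) b \/ edge b (F a) -> exists a', F a' = b.

Lemma nbhd_embedding r c x : nbhd r (F c) (F x) <-> nbhd r c x.
Proof.
elim: r x => [|r IH] x /=; first by split=> [/injF|->].
split=> -[/IH|[y [cy [yx exy]]]]; try by left.
- have [y' yE] : exists y', F y' = y by apply: (closedF (a := x)); tauto.
  subst y; right; exists y'; split; first exact/IH.
  by split=> [e|]; [apply: yx; rewrite e | rewrite -!edgeF].
- right; exists (F y); split; first exact/IH.
  by split=> [/injF //|]; rewrite !edgeF.
Qed.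

Lemma nbhd_in_image r c b : nbhd r (F c) b -> exists a, F a = b.
Proof.
elim: r b => [|r IH] b /=; first by move->; exists c.
move=> [/IH //|[y [/IH [a <-]] [_ eab]]].
exact: closedF eab.
Qed.

(** Locality, applied in [A] and in [B], replaces each side by truth in an induced substructure.
    Balls do not leave the image of [F], so [F] restricts to an isomorphism between these
    substructures. *)
Lemma local_embedding r ys z phi (v : nat -> A) :
  local_around r ys z phi -> sat v phi <-> sat (F \o v) phi.
Proof.
move=> loc.
pose SA x := (exists2 y, y \in ys & x = v y) \/ nbhd r (v z) x.
pose SB x := (exists2 y, y \in ys & x = (F \o v) y) \/ nbhd r ((F \o v) z) x.
have SAz : SA (v z) by right; elim: r {loc SA SB} => //= r IH; left.
(* Assignments are total: variables outside [z :: ys] get the default [v z], the centre of the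
   ball. *)
have SAy y : SA (if y \in z :: ys then v y else v z).
  by rewrite inE; case: eqP => [->|_] //=; case: ifP => // yys; left; exists y.
have SAB x : SA x -> SB (F x).
  move=> [[y yys ->]|xz]; first by left; exists y.
  by right; apply/nbhd_embedding.
pose w y : induced SA := exist SA _ (SAy y).
have wE y : y \in z :: ys -> sval (w y) = v y by rewrite /= => ->.
pose G (x : induced SA) : induced SB := exist SB (F (sval x)) (SAB _ (svalP x)).
have locA := loc A v w wE.
have locB : sat (F \o v) phi <-> sat (G \o w) phi.
  by apply: (loc B (F \o v) (G \o w)) => y /wE /= ->.
have iso : sat w phi <-> sat (G \o w) phi; last by tauto.
apply: sat_isomorphism => [[x px] [y py]|[b sb]|[x px] [y py]].
- move=> /(congr1 sval) /= /injF xy; subst y.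
  by rewrite (proof_irrelevance _ px py).
- have [a [aE sa]] : exists a, F a = b /\ SA a.
    case: (sb) => [[y yys bE]|bz].
      by exists (v y); split; [rewrite bE | left; exists y].
    have [a aE] := nbhd_in_image bz; exists a; split=> //.
    by right; apply/nbhd_embedding; rewrite aE.
  subst b; exists (exist SA a sa).
  by rewrite /G /=; congr exist; apply: proof_irrelevance.
- exact: edgeF.
Qed.

End ComponentEmbedding.

(** A normal form survives the removal of components that contain no witness: the witnesses are
    pulled back along [F], and each [a] in [A] inherits the local formula from [F a]. *)
Lemma BSNF_transfer (A B : structure) (F : A -> B) r ys z phi (v : nat -> B) :
    injective F -> (forall x y, edge (F x) (F y) <-> edge x y) ->
    (forall a b, edge (F a) b \/ edge b (F a) -> exists a', F a' = b) ->
    {subset free_vars phi <= z :: ys} -> local_around r ys z phi ->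
    sat v (Forall z phi) -> (forall y, y \in ys -> exists a, F a = v y) ->
  models A (foldr Exists (Forall z phi) ys).
Proof.
move=> injF edgeF closedF sub loc satv ysF u.
(* The preimages are only known to exist, so they are gathered one variable at a time along the
   list. *)
have [w wu wv] : exists2 w : nat -> A,
    (forall x, x \notin ys -> w x = u x) & {in ys, forall y, F (w y) = v y}.
  elim: ys ysF {sub loc} => [|y ys IH] ysF; first by exists u.
  have [w wu wv] : exists2 w : nat -> A,
      (forall x, x \notin ys -> w x = u x) & {in ys, forall y, F (w y) = v y}.
    by apply: IH => x xys; apply: ysF; rewrite inE xys orbT.
  have [a aE] := ysF y (mem_head _ _).
  exists (update w y a) => x; rewrite inE /update; case: eqVneq => [->|_] //=.
    exact: wu.
  exact: wv.
apply/sat_exists_witness; exists w => // a.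
apply: (proj2 (local_embedding injF edgeF closedF _ loc)).
apply: (proj1 (sat_coincidence _) (satv (F a))) => x /sub.
rewrite /= /update inE; case: eqVneq => //= _ xys.
by rewrite wv.
Qed.

Lemma foldr_Exists_size (f : formula) ys :
  fsize (foldr Exists f ys) = 2 * size ys + fsize f.
Proof. by rewrite /fsize; elim: ys => //= y ys ->; lia. Qed.

(** * Forests recognised by a depth function and unique parents *)

Section GradedForest.
Variables (T : finType) (e : rel T) (depth : T -> nat) (h : nat).
Hypothesis depth_edge : forall x y, e x y -> depth y = (depth x).+1.
Hypothesis parent_unique : forall x y z, e x z -> e y z -> x = y.

(* Both neighbours on a cycle of a vertex of maximal depth are its parent. *)
Lemma graded_acyclic : undirected_acyclic e.
Proof.
split=> [x y exy|c /andP[cyc un]].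
  by apply/negP => /depth_edge; rewrite (depth_edge exy); lia.
rewrite leqNgt; apply/negP => szc.
have [x0 x0c] : exists x, x \in c.
  by case: c szc {cyc un} => // x c; exists x; rewrite mem_head.
pose x := [arg max_(x > x0 in c) depth x].
have [xc xmax] : x \in c /\ forall y, y \in c -> depth y <= depth x.
  by rewrite /x; case: arg_maxnP.
have [i s E] := rot_to xc.
have mem_s y : y \in x :: s -> depth y <= depth x.
  by rewrite -E mem_rot; apply: xmax.
have up y : y \in x :: s -> undirected e x y -> e y x.
  by move=> /mem_s dy /orP[/depth_edge|//]; lia.
have szs : 2 < size (x :: s) by rewrite -E size_rot.
move: cyc un; rewrite -(rot_cycle i) -(rot_uniq i) E => cyc un.
case: s mem_s up szs cyc un {E} => // y s _.
case: (lastP s) => // {}s z up _ /=.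
rewrite !rcons_path last_rcons => /and3P[exy _ ezx] /and3P[_ ys _].
have eyx : e y x by apply: up => //; rewrite !inE eqxx orbT.
have {}ezx : e z x.
  by apply: up; rewrite 1?/undirected 1?orbC // !inE mem_rcons mem_head !orbT.
by move: ys; rewrite (parent_unique eyx ezx) mem_rcons mem_head.
Qed.

Lemma graded_forest : 0 < #|T| -> is_forest e.
Proof.
split=> //; last exact: graded_acyclic.
move=> x; apply/card_le1_eqP => y z; rewrite !inE => yx zx.
exact: parent_unique zx yx.
Qed.

Lemma graded_height : (forall x, depth x <= h) -> height e <= h.
Proof.
move=> dh; apply/bigmax_leqP => x _; apply/bigmax_leqP => n /existsP[p].
case/andP=> ep _; rewrite -(size_tuple p).
suff E : depth (last x p) = depth x + size p by have := dh (last x p); lia.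
by elim: (tval p) x ep => [|y s IH] x /= => [_|/andP[/depth_edge dy /IH]]; lia.
Qed.

End GradedForest.

(** * Binary digits and the tower function *)

Definition bit (n j : nat) : bool := odd (n %/ 2 ^ j).

(** Strong induction by halving: digit 0 is the parity, and the other digits are those of the half.
    Halving decreases only positive numbers, so [n = 0] is separate. *)
Lemma bit_inj n m : bit n =1 bit m -> n = m.
Proof.
elim/ltn_ind: n m => n IH m E.
have E0 : odd n = odd m by have := E 0; rewrite /bit !divn1.
have EE : bit (n %/ 2) =1 bit (m %/ 2).
  by move=> j; have := E j.+1; rewrite /bit expnS !divnMA.
have [n0|n_gt0] := posnP n; last first.
  by have := IH (n %/ 2) _ _ EE; lia.
subst n; apply/eqP; rewrite eq_sym; apply/negPn/negP => m_neq0.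
(* This is the position of the leading digit of [m], which is 1, whereas all digits of 0 vanish. *)
have := E (trunc_log 2 m).
have /andP[lo hi] := trunc_log_bounds (isT : 1 < 2) (n := m) ltac:(lia).
rewrite /bit div0n; have -> // : m %/ 2 ^ trunc_log 2 m = 1.
apply/eqP; rewrite eqn_leq -ltnS ltn_divLR ?divn_gt0 ?expn_gt0 //.
by rewrite mulnC -expnSr hi lo.
Qed.

Lemma bit_leq_expn n j : bit n j -> 2 ^ j <= n.
Proof. by apply: contraLR; rewrite -ltnNge /bit => /divn_small->. Qed.

(** One step down in a coding tree removes one exponential: [2 ^ j <= n < 2 ^ Tower k]. *)
Lemma bit_lt_Tower k n j : n < Tower k.+1 -> bit n j -> j < Tower k.
Proof.
rewrite /Tower /= => nk nj; rewrite -(@ltn_exp2l 2) //.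
exact: leq_ltn_trans (bit_leq_expn nj) nk.
Qed.

Lemma bit_lt_Tower0 n j : n < Tower 0 -> bit n j = false.
Proof. by rewrite /Tower /=; case: n => // _; rewrite /bit div0n. Qed.

Lemma Tower_gt0 k : 0 < Tower k.
Proof. by case: k => // k; rewrite /Tower /= expn_gt0. Qed.

(** * Comparing codes by a formula of linear size *)

(** This is bisimilarity for [k] rounds with the forth and back conditions merged: a child [u] of
    either vertex is answered by a child [w] of the other. Zero rounds suffice below [Tower 0],
    where the only code is 0. *)
Fixpoint same_code (A : structure) (k : nat) (a b : A) : Prop :=
  if k is k'.+1 then
    forall u : A, edge a u \/ edge b u -> exists w : A,
      ((edge a u -> edge b w) /\ (edge b u -> edge a w)) /\ same_code k' u w
  else True.

(* Treating the children of [x] and of [y] by the same quantifiers keeps a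
single recursive call; four variables suffice because [x] and [y] may be
requantified below. *)
Fixpoint same_code_formula (k x y u w : nat) : formula :=
  if k is k'.+1 then
    Forall u (Imp (Or (Edge x u) (Edge y u))
      (Exists w (And (And (Imp (Edge x u) (Edge y w)) (Imp (Edge y u) (Edge x w)))
                     (same_code_formula k' u w x y))))
  else Equal x x.

Lemma same_code_formulaE (A : structure) k x y u w (v : nat -> A) :
  uniq [:: x; y; u; w] ->
  sat v (same_code_formula k x y u w) <-> same_code k (v x) (v y).
Proof.
elim: k x y u w v => [|k IH] x y u w v un //=.
move: (un); rewrite /= !inE !negb_or andbT.
case/and3P=> /and3P[_ xu xw] /andP[yu yw] uw.
have un' : uniq [:: u; w; x; y].
  by rewrite (@perm_uniq _ _ [:: x; y; u; w]) // (perm_catC [:: u; w] [:: x; y]).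
have E a b : sat (update (update v u a) w b) (same_code_formula k u w x y)
    <-> same_code k a b.
  have := IH _ _ _ _ (update (update v u a) w b) un'.
  by rewrite /update eqxx (negbTE uw) eqxx.
have step a b :
    sat (update (update v u a) w b)
      (And (And (Imp (Edge x u) (Edge y w)) (Imp (Edge y u) (Edge x w)))
           (same_code_formula k u w x y)) <->
    ((edge (v x) a -> edge (v y) b) /\ (edge (v y) a -> edge (v x) b)) /\
    same_code k a b.
  have := E a b; rewrite /= /update !eqxx (negbTE xu) (negbTE xw).
  by rewrite (negbTE yu) (negbTE yw) (negbTE uw); tauto.
have dom a : sat (update v u a) (Or (Edge x u) (Edge y u)) <->
    edge (v x) a \/ edge (v y) a.
  by rewrite /= /update eqxx (negbTE xu) (negbTE yu).
split=> H a /dom /H [b /step Hb]; by exists b.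
Qed.

Lemma size_same_code_formula k x y u w :
  fsize (same_code_formula k x y u w) = 58 * k + 3.
Proof.
rewrite /fsize; elim: k x y u w => [|k IH] x y u w //=.
by rewrite !size_cat /= IH; lia.
Qed.

(** A multirule that turns membership in the free variables of a compound formula into a boolean
    condition within reach of [lia], leaving the recursive subformula opaque. *)
Lemma mem_free_varsE t :
  (((forall x f, (t \in free_vars (Forall x f)) = (t != x) && (t \in free_vars f)) *
    (forall x f, (t \in free_vars (Exists x f)) = (t != x) && (t \in free_vars f)) *
    (forall f, (t \in free_vars (Not f)) = (t \in free_vars f))) *
   ((forall f g, (t \in free_vars (And f g)) =
       (t \in free_vars f) || (t \in free_vars g)) *
    (forall f g, (t \in free_vars (Or f g)) =
       (t \in free_vars f) || (t \in free_vars g)) *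
    (forall f g, (t \in free_vars (Imp f g)) =
       (t \in free_vars f) || (t \in free_vars g))) *
   ((forall x y, (t \in free_vars (Edge x y)) = (t == x) || (t == y)) *
    (forall x y, (t \in free_vars (Equal x y)) = (t == x) || (t == y))))%type.
Proof. by do !split=> * /=; rewrite ?mem_filter ?mem_cat ?inE. Qed.

Lemma free_vars_same_code_formula k x y u w :
  {subset free_vars (same_code_formula k x y u w) <= [:: x; y]}.
Proof.
elim: k x y u w => [|k IH] x y u w t; first by rewrite !inE orbb => ->.
rewrite [same_code_formula _ _ _ _ _]/= !mem_free_varsE.
have := IH u w x y t; rewrite !inE.
by case: (t \in _) => [/(_ isT)|_]; lia.
Qed.

Definition root_formula (x y : nat) : formula := Forall y (Not (Edge y x)).

Definition twin_formula (h : nat) : formula :=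
  Forall 0 (Imp (root_formula 0 1)
    (Exists 1 (And (And (Not (Equal 0 1)) (root_formula 1 2))
                   (same_code_formula h 0 1 2 3)))).

Lemma sentence_twin_formula h : sentence (twin_formula h).
Proof.
apply/eqP; rewrite -size_eq0 -leqn0 leqNgt -has_predT; apply/hasP => -[t].
have := @free_vars_same_code_formula h 0 1 2 3 t.
rewrite !mem_free_varsE !inE.
by case: (t \in _) => [/(_ isT)|_]; lia.
Qed.

Lemma twin_formulaE (A : structure) h :
  models A (twin_formula h) <->
  ((nat -> A) -> forall a : A, (forall b, ~ edge b a) -> exists2 b : A,
     a <> b & (forall c, ~ edge c b) /\ same_code h a b).
Proof.
have E (v : nat -> A) a b :
    sat (update (update v 0 a) 1 b) (same_code_formula h 0 1 2 3) <->
    same_code h a b by apply: same_code_formulaE.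
split=> [H v a ra|H v a ra].
  by have [b [[nab rb] /E sab]] := H v a ra; exists b.
by have [b nab [rb sab]] := H v a ra; exists b; split; [|apply/E].
Qed.

(** * The forest of coding trees *)

Section CodeForest.
Variable h : nat.
Let contains : rel 'I_(Tower h) := fun i j => bit i j.

(** Each step lowers the tower bound by one level, and 0, the only number below [Tower 0], has no
    digit to descend to. Hence trails of length at most [h] describe whole trees. *)
Lemma size_contains_path k (i : 'I_(Tower h)) p :
  i < Tower k -> path contains i p -> size p <= k.
Proof.
elim: p i k => [|j p IH] i [|k] //= ik /andP[ij pj].
  by rewrite /contains (bit_lt_Tower0 _ ik) in ij.
by apply: IH pj; apply: bit_lt_Tower ij.
Qed.

(* A vertex is a copy [(b, i)] of the tree coding [i], with [(b, i)] in [R],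
together with a descending path [p] from its root. *)
Definition is_vertex (R : {set bool * 'I_(Tower h)})
    (x : (bool * 'I_(Tower h)) * {bseq h of 'I_(Tower h)}) : bool :=
  (x.1 \in R) && path contains x.1.2 x.2.

Definition vertex R : finType := {x | is_vertex R x}.

Section Fixed.
Variable R : {set bool * 'I_(Tower h)}.
Implicit Types x y z : vertex R.

Definition tree_of x : bool * 'I_(Tower h) := (val x).1.
Definition trail x : seq 'I_(Tower h) := (val x).2.
Definition code x : 'I_(Tower h) := last (tree_of x).2 (trail x).

Definition arc : rel (vertex R) := fun x y =>
  (tree_of x == tree_of y) && [exists l, trail y == rcons (trail x) l].

Lemma arcP x y :
  reflect (tree_of x = tree_of y /\ exists l, trail y = rcons (trail x) l)
          (arc x y).
Proof.
apply: (iffP andP) => [[/eqP xy /existsP[l /eqP yl]]|[xy [l yl]]].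
  by split=> //; exists l.
by split; [apply/eqP | apply/existsP; exists l; apply/eqP].
Qed.

Lemma vertex_eq x y : tree_of x = tree_of y -> trail x = trail y -> x = y.
Proof.
rewrite /tree_of /trail => Et Ep; apply/val_inj.
by rewrite [LHS]surjective_pairing Et (val_inj Ep) -surjective_pairing.
Qed.

Lemma tree_ofP x : tree_of x \in R.
Proof. by case/andP: (valP x). Qed.

Lemma trailP x : path contains (tree_of x).2 (trail x).
Proof. by case/andP: (valP x). Qed.

Lemma vertex_exists r p : r \in R -> path contains r.2 p ->
  exists2 x, tree_of x = r & trail x = p.
Proof.
move=> rR rp; have sz := size_contains_path (ltn_ord r.2) rp.
have rpV : is_vertex R (r, Bseq sz) by apply/andP.
by exists (Sub (r, Bseq sz) rpV); rewrite /tree_of /trail SubK.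
Qed.

Lemma arc_parent x y z : arc x z -> arc y z -> x = y.
Proof.
move=> /arcP[xz [l zl]] /arcP[yz [m zm]]; apply: vertex_eq; first by rewrite xz.
by move: zl; rewrite zm => /rcons_inj[].
Qed.

Lemma arc_depth x y : arc x y -> size (trail y) = (size (trail x)).+1.
Proof. by move=> /arcP[_ [l ->]]; rewrite size_rcons. Qed.

Lemma arc_code x y : arc x y -> bit (code x) (code y).
Proof.
move=> /arcP[xy [l yl]]; have := trailP y.
by rewrite /code yl last_rcons rcons_path xy => /andP[].
Qed.

Lemma bit_code_arc x (j : nat) : bit (code x) j ->
  exists2 y, arc x y & code y = j :> nat.
Proof.
(* Here [j < 2 ^ j <= code x < Tower h]. *)
move=> xj; have jh : j < Tower h.
  apply: ltn_trans (ltn_ord (code x)).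
  exact: leq_trans (ltn_expl j (isT : 1 < 2)) (bit_leq_expn xj).
pose p := rcons (trail x) (Ordinal jh).
have [|y ytree ytrail] := @vertex_exists (tree_of x) p (tree_ofP x).
  by rewrite rcons_path trailP.
exists y; last by rewrite /code ytrail last_rcons.
by apply/arcP; split=> //; exists (Ordinal jh).
Qed.

Lemma root_trail x : (forall y, ~ arc y x) <-> trail x = [::].
Proof.
split=> [rx|xnil y /arcP[_ [l]]]; last by rewrite xnil; case: (trail y).
have := trailP x; move xE: (trail x) => q; case/lastP: q xE => // p l xE.
rewrite rcons_path => /andP[xp _].
have [y yt yp] := vertex_exists (tree_ofP x) xp.
by case: (rx y); apply/arcP; rewrite yp; split=> //; exists l.
Qed.

Lemma arc_forest : R != set0 -> is_forest arc.
Proof.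
case/set0Pn=> r rR; apply: graded_forest arc_depth arc_parent _.
have [x _ _] := @vertex_exists r [::] rR isT.
by apply/card_gt0P; exists x.
Qed.

Lemma arc_height : height arc <= h.
Proof.
by apply: graded_height arc_depth _ => x; apply: size_bseq.
Qed.

(** The answer to a child is a child of the other vertex with the same code. If [u] lies below both
    [x] and [y], then [x = y] by uniqueness of parents, and the answer also lies below both. *)
Lemma same_code_complete k (x y : graph arc) :
  code x = code y -> same_code k x y.
Proof.
elim: k x y => //= k IH x y xy u [xu|yu].
  have [|w yw wu] := @bit_code_arc y (code u); first by rewrite -xy arc_code.
  exists w; split; [split=> // yu | by apply: IH; apply/val_inj].
  by rewrite (arc_parent xu yu).
have [|w xw wu] := @bit_code_arc x (code u); first by rewrite xy arc_code.
exists w; split; [split=> // xu | by apply: IH; apply/val_inj].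
by rewrite -(arc_parent xu yu).
Qed.

(** Children of vertices with codes below [Tower k.+1] have codes below [Tower k], so by induction a
    child and its answer code the same number. Thus both vertices have the same digits. *)
Lemma same_code_sound k (x y : graph arc) :
  code x < Tower k -> code y < Tower k -> same_code k x y -> code x = code y.
Proof.
move=> xk yk sxy; apply/val_inj/bit_inj => j /=.
elim: k x y j xk yk sxy => [|k IH] x y j xk yk sxy.
  by rewrite !bit_lt_Tower0.
have codes (u w : graph arc) :
    same_code k u w -> code u < Tower k -> code w < Tower k ->
    code u = code w :> nat.
  by move=> uw uk wk; apply: bit_inj => i; apply: IH.
apply/idP/idP => [/bit_code_arc[u xu uj]|/bit_code_arc[u yu uj]].
- have [|w [[/(_ xu) yw _] /codes uw]] := sxy u; first by left.
  have uk := bit_lt_Tower xk (arc_code xu).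
  have wk := bit_lt_Tower yk (arc_code yw).
  by rewrite -uj uw // arc_code.
- have [|w [[_ /(_ yu) xw] /codes uw]] := sxy u; first by right.
  have uk := bit_lt_Tower yk (arc_code yu).
  have wk := bit_lt_Tower xk (arc_code xw).
  by rewrite -uj uw // arc_code.
Qed.

End Fixed.

(** * Deleting one tree, and the lower bound *)

Lemma twin_all : models (graph (@arc setT)) (twin_formula h).
Proof.
apply/twin_formulaE => _ x /root_trail xnil.
pose t := (~~ (tree_of x).1, (tree_of x).2).
have [y yt ynil] := @vertex_exists setT t [::] (in_setT _) isT.
exists y; first by move=> xy; move: yt; rewrite -xy /t; case: tree_of => [[] i].
split; first exact/root_trail.
by apply: same_code_complete; rewrite /code xnil ynil yt.
Qed.

(** The root of the other copy of the tree [r] loses its twin: a distinct root with the same code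
    could only belong to the deleted tree. *)
Lemma twin_all_but_one r : ~ models (graph (@arc (~: [set r]))) (twin_formula h).
Proof.
have rR : (~~ r.1, r.2) \in ~: [set r] by rewrite !inE; case: r => [[] i].
have [x xt xnil] := @vertex_exists _ _ [::] rR isT.
move=> /twin_formulaE/(_ (fun=> x) x) [|y xy [/root_trail ynil sxy]].
  exact/root_trail.
have := same_code_sound (ltn_ord _) (ltn_ord _) sxy.
rewrite /code xnil ynil xt /= => yc.
have := tree_ofP y; rewrite !inE => /negP; apply; apply/eqP.
apply: contra_not_eq xy => yr; apply: vertex_eq; last by rewrite xnil.
move: yr; rewrite xt [RHS]surjective_pairing -yc -pair_eqE /pair_eq -yc eqxx andbT.
by case: r.1 (tree_of y).1 => [] [].
Qed.

Definition widen_vertex R (x : vertex R) : vertex setT :=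
  Sub (val x) (introT andP (conj (in_setT _) (trailP x))).

Lemma tree_of_widen R (x : vertex R) : tree_of (widen_vertex x) = tree_of x.
Proof. by []. Qed.

Lemma trail_widen R (x : vertex R) : trail (widen_vertex x) = trail x.
Proof. by []. Qed.

(** Trees are kept or deleted as a whole, so the tree of a vertex decides whether it survives. As
    arcs stay inside a tree, this yields the closure condition for local formulas. *)
Lemma widen_vertex_image (R : {set bool * 'I_(Tower h)}) (x : vertex setT) :
  tree_of x \in R -> exists y : vertex R, widen_vertex y = x.
Proof.
move=> xR; have [y yt yp] := vertex_exists xR (trailP x).
by exists y; apply: vertex_eq; rewrite ?tree_of_widen ?trail_widen.
Qed.

Lemma BSNF_size psi :
  BSNF psi -> equiv_on_forests h (twin_formula h) psi -> Tower h < fsize psi.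
Proof.
move=> [ys [z [phi [r [_ sub loc ->]]]]] equiv.
rewrite foldr_Exists_size ltnNge; apply/negP => small.
have := twin_all; have r0 : bool * 'I_(Tower h) := (true, Ordinal (Tower_gt0 h)).
have forestT : is_forest (@arc setT).
  by apply: arc_forest; apply/set0Pn; exists r0.
have [x0 _ _] := @vertex_exists setT r0 [::] (in_setT _) isT.
move=> /(equiv _ _ forestT (arc_height _)) /(_ (fun=> x0)).
move=> /(sat_exists_witness (A := graph (@arc setT)))[v _ satv].
(* These are the trees that contain a witness. *)
pose hit : seq (bool * 'I_(Tower h)) := map (fun y : nat => tree_of (v y)) ys.
have szhit : size hit = size ys by rewrite size_map.
have [t tP] : exists t, t \notin hit.
  apply/existsP; rewrite -negb_forall; apply/negP => /forallP all_hit.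
  have : #|{: bool * 'I_(Tower h)}| <= size hit.
    by apply: leq_trans (card_size _); apply/subset_leq_card/subsetP.
  (* Each existential quantifier costs two symbols, so there are at most [Tower h / 2] witnesses for
     [2 * Tower h] trees; positivity of [Tower h] makes the gap strict. *)
  by rewrite card_prod card_bool card_ord szhit; have := Tower_gt0 h; lia.
(* Without the tree [t] all witnesses remain, so the normal form still holds, and with it the twin
   sentence. *)
apply: (@twin_all_but_one t).
have forestR : is_forest (@arc (~: [set t])).
  apply: arc_forest; apply/set0Pn; exists (~~ t.1, t.2); rewrite !inE.
  by case: t {tP} => [[] i].
apply/(equiv _ _ forestR (arc_height _)).
pose F : graph (@arc (~: [set t])) -> graph (@arc setT) := @widen_vertex _.
apply: (BSNF_transfer (F := F) _ _ _ sub loc satv).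
- rewrite /F => x y xy; apply: vertex_eq.
    by rewrite -tree_of_widen xy.
  by rewrite -trail_widen xy.
- by [].
- move=> a b ab; apply: widen_vertex_image.
  by case: ab => /arcP[E _]; [rewrite -E | rewrite E]; apply: tree_ofP.
- move=> y yys; apply: widen_vertex_image; rewrite !inE.
  by apply: contraNneq tP => <-; apply: map_f.
Qed.

End CodeForest.

Theorem theorem9 :
  exists phi : nat -> formula,
    [/\ forall h : nat, 1 <= h -> sentence (phi h),
        exists C : nat, forall h : nat, 1 <= h -> fsize (phi h) <= C * h
      & forall h : nat, 1 <= h ->
          forall psi : formula, BSNF psi -> equiv_on_forests h (phi h) psi ->
            Tower h < fsize psi].
Proof.
exists twin_formula; split=> [h _|| h _ psi]; last 1 first.
- exact: BSNF_size.
- exact: sentence_twin_formula.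
(* The exact size is [58 * h + 38], and [h >= 1]. *)
exists 100 => h h_gt0.
rewrite /fsize /= !size_cat /= -/(fsize _).
by rewrite size_same_code_formula; lia.
Qed.
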